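(* There exist constants $C_1,C_2>0$ that do not depend on $\alpha$, $a$, and the $X_i$ such that the following holds. Let $\alpha\ge1$, $\frac1\alpha+\frac1\beta=1$, let $X_1,\dots,X_n$ be independent mean-zero real random variables with $\|X_i\|_{\Psi_\alpha}<\infty$, and let $a=(a_1,\dots,a_n)$ be any $n$-dimensional real vector. If $\alpha\ge2$, then $$\left\|\sum_{i=1}^n a_iX_i\right\|_{\Psi_\alpha}\le C_1\left(\sum_{i=1}^n|a_i|^\beta\|X_i\|_{\Psi_\alpha}^\beta\right)^{\frac1\beta},\qquad\left\|\sum_{i=1}^n a_iX_i\right\|_{\Psi_2}\le C_1\left(\sum_{i=1}^n a_i^2\|X_i\|_{\Psi_\alpha}^2\right)^{\frac12},$$ and if $\alpha\in[1,2]$, then $$\left\|\sum_{i=1}^n a_iX_i\right\|_{\Psi_\alpha}\le C_2\left(\sum_{i=1}^n a_i^2\|X_i\|_{\Psi_\alpha}^2\right)^{\frac12}.$$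
   Context: For a real random variable $X$ and $\alpha\ge1$, the Orlicz norm is $\|X\|_{\Psi_\alpha}:=\inf\{u>0:\ \mathbb E\exp((|X|/u)^\alpha)\le 2\}$. Constants are universal. *)

(* Defs.v *)
From mathcomp Require Import all_boot all_order all_algebra.
From mathcomp Require Import all_classical all_reals all_analysis.

Set Implicit Arguments.
Unset Strict Implicit.
Unset Printing Implicit Defensive.

Import Order.TTheory GRing.Theory Num.Theory.
Import numFieldNormedType.Exports.

Local Open Scope classical_set_scope.
Local Open Scope ring_scope.

(* The infimum is taken in \bar R, so the norm is +oo when no u qualifies. *)
Definition orlicz_norm d (T : measurableType d) (R : realType)
    (P : probability T R) (alpha : R) (X : T -> R) : \bar R :=
  ereal_inf [set u%:E | u in
    [set u : R | 0 < u /\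
      ('E_P[fun w => expR ((`|X w| / u) `^ alpha)] <= 2%:E)%E]].

(* The product rule is required for every subfamily J and all Borel sets. *)
Definition mutually_independent d (T : measurableType d) (R : realType)
    (P : probability T R) (I : finType) (X : I -> {RV P >-> R}) : Prop :=
  forall (J : {set I}) (B : I -> set R),
    (forall i, i \in J -> measurable (B i)) ->
    P (\bigcap_(i in [set` J]) (X i @^-1` B i)) =
      (\prod_(i in J) P (X i @^-1` B i))%E.

(* Main.v *)
Require Import Defs.
From mathcomp Require Import all_boot all_order all_algebra.
From mathcomp Require Import all_classical all_reals all_analysis.
From mathcomp Require Import finmap measurable_realfun ring lra.

Set Implicit Arguments.
Unset Strict Implicit.
Unset Printing Implicit Defensive.

Import Order.TTheory GRing.Theory Num.Theory.
Import numFieldNormedType.Exports.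

(** Write [N i] for the norm of [X i]. The Orlicz bound on a sum is read off its
    moment generating function, along the scale of arguments
    [s = v `^ (alpha - 1)] with [1 <= v], where a variable whose norm is of
    order 1 has a moment generating function at most [expR (K * v `^ alpha)].

    For one variable [Y] with mean zero and [E expR (`|Y| `^ alpha) <= 2], the
    logarithm of [E expR (t * Y)] is at most [K * b] as soon as
    [`|t| * x <= x `^ alpha + b] for all [x >= 0] (a Young inequality) and
    [min (t ^+ 2, 1) <= b] (lemma [mgf_le]). With [t = v `^ (alpha - 1) * c] one
    may take [b = v `^ alpha * c `^ 2] if [alpha <= 2] and [c <= 1], and
    [b = v `^ alpha * c `^ beta] if [alpha >= 2]. This is the only place where
    the two regimes differ ([young_subquadratic], [powR_rescale]).

    By independence the logarithms add up: the product rule for sets extends to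
    [E (prod_i g_i (X_i)) = prod_i E (g_i (X_i))] for nonnegative [g_i]
    ([independent_integral_prod]). Let [u i > N i], so that [X i / u i] is
    normalized as [Y] above. If the [q]-th powers of the numbers
    [`|a i| * u i / A] sum to at most 1 (with [q = 2] or [q = beta]), then the
    moment generating function of [S / A], where [S] is the weighted sum, is at
    most [expR (K * v `^ alpha)] at [+- v `^ (alpha - 1)]. Letting [u i] tend to
    [N i] afterwards gives the bound by the norms ([orlicz_norm_sum_le]).

    The converse passage ([orlicz_of_mgf]) is a Chernoff bound at each integer
    level of [`|S / (3 * K * A)| `^ alpha], summed over the levels; it bounds
    [E expR (`|S / (3 * K * A)| `^ alpha)] by the constant [expR 1 + 4], and
    convexity of [expR] turns that constant into 2 after one more division. No
    constant depends on [alpha].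

    For [alpha >= 2] the bound on the [Psi_2] norm of [S] follows from the
    estimate with exponent 2, because the [Psi_2] norm of each [X i] is at most
    [2 * expR 1] times its [Psi_alpha] norm. *)

Local Open Scope classical_set_scope.
Local Open Scope ring_scope.

(** * Inequalities for real numbers *)

Lemma expR_le_quadratic (R : realType) (y : R) :
  expR y <= 1 + y + y ^+ 2 * expR `|y|.
Proof.
have e0 := expR_gt0 y; have := expR_ge1Dx (- y); rewrite expRN => h.
have {}h : expR y * (1 - y) <= 1 by rewrite mulrC -ler_pdivlMr// div1r.
have [y0|y0] := leP 0 y.
  rewrite ger0_norm//; have ? : (1 + y) * (expR y * (1 - y)) <= (1 + y) * 1.
    by apply: ler_wpM2l => //; lra.
  by lra.
rewrite ltr0_norm//.
(* [expR y <= 1 / (1 - y) = 1 + y + y ^+ 2 / (1 - y)] *)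
have e1 : 1 <= expR (- y) by rewrite -expR0 ler_expR; lra.
rewrite -(@ler_pM2r _ (1 - y)); last lra.
apply: (le_trans h).
have : y ^+ 2 * 1 <= y ^+ 2 * (expR (- y) * (1 - y)).
  by apply: ler_wpM2l; [exact: sqr_ge0|nra].
by lra.
Qed.

(** Second-order expansion with an error that stays integrable when only
    [expR `|x|] is: half of the exponential absorbs [x ^+ 2], which leaves
    room only for [`|s| <= 2^-1]. *)
Lemma expR_scale_le (R : realType) (s x : R) : `|s| <= 2^-1 ->
  expR (s * x) <= 1 + s * x + 8 * s ^+ 2 * expR `|x|.
Proof.
move=> s2; apply: (le_trans (expR_le_quadratic _)); rewrite lerD2l.
rewrite exprMn normrM.
have x0 := normr_ge0 x.
have x2 : x ^+ 2 <= 8 * expR (`|x| / 2).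
  have := @expR_ge1Dxn R (`|x| / 2) 1 (divr_ge0 x0 (ler0n _ 2)).
  rewrite -[x ^+ 2]real_normK ?num_real// (_ : 2`! = 2)%N//; lra.
have h : expR (`|s| * `|x|) <= expR (`|x| / 2).
  by rewrite ler_expR mulrC ler_wpM2l.
have -> : expR `|x| = expR (`|x| / 2) * expR (`|x| / 2).
  by rewrite -expRD; congr expR; field.
rewrite -(mulrA (s ^+ 2)) (mulrC 8) -(mulrA (s ^+ 2)) (mulrA 8).
apply: ler_wpM2l; first exact: sqr_ge0.
by apply: ler_pM => //; rewrite ?sqr_ge0 ?expR_ge0.
Qed.

(** Convexity of [expR] on the segment from 0 to [y]. *)
Lemma expR_div_le (R : realType) (M y : R) : 1 <= M ->
  expR (y / M) <= 1 + M^-1 * expR y.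
Proof.
move=> M1; have M0 : 0 < M by lra.
set z := y / M; have -> : y = z + (M - 1) * z by rewrite /z; field; lra.
rewrite expRD -(@ler_pM2l _ M)// mulrDr mulr1 mulVKf ?gt_eqF//.
have ez := expR_gt0 z; have h1 := expR_ge1Dx ((M - 1) * z).
have := expR_ge1Dx (- z); rewrite expRN => h.
have {}h : expR z * (1 - z) <= 1 by rewrite mulrC -ler_pdivlMr// div1r.
have : expR z * (1 + (M - 1) * z) <= expR z * expR ((M - 1) * z).
  by rewrite ler_pM2l.
by nra.
Qed.

Lemma ler_1DpowR (R : realType) (p q x : R) : 0 < p -> p <= q -> 0 <= x ->
  x `^ p <= 1 + x `^ q.
Proof.
move=> p0 pq x0; have [x1|x1] := leP x 1.
  rewrite (@le_trans _ _ 1)// ?lerDl ?powR_ge0//.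
  have -> : 1 = 1 `^ p :> R by rewrite powR1.
  by apply: ge0_ler_powR => //; rewrite ?nnegrE// ltW.
by rewrite (@le_trans _ _ (x `^ q))// ?lerDr// ler_powR// ltW.
Qed.

(** If [x <= v * a] the second term dominates; otherwise the first does, since
    [a <= a `^ (alpha - 1)] when [a <= 1] and [alpha - 1 <= 1]. *)
Lemma young_subquadratic (R : realType) (alpha a v x : R) :
  1 <= alpha -> alpha <= 2 -> 0 <= a <= 1 -> 0 <= v -> 0 <= x ->
  v `^ (alpha - 1) * a * x <= x `^ alpha + v `^ alpha * a `^ 2.
Proof.
move=> al1 al2 /andP[a0 a1] v0 x0.
have al0 : 0 < alpha by lra.
have -> : a `^ 2 = a * a by rewrite -[2]/(2%:R) powR_mulrn.
have := powR_ge0 v (alpha - 1); set q := v `^ _ => q0.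
rewrite -(mulr_powRB1 v0 al0) -/q -(mulr_powRB1 x0 al0).
have [xv|vx] := leP x (v * a).
  apply: (@le_trans _ _ (v * q * (a * a))).
    rewrite (_ : v * q * _ = q * a * (v * a)); last by ring.
    by rewrite ler_wpM2l// mulr_ge0.
  by rewrite lerDr mulr_ge0 ?powR_ge0.
apply: (@le_trans _ _ (x * x `^ (alpha - 1))); last first.
  by rewrite lerDl !mulr_ge0.
rewrite [leLHS]mulrC; apply: ler_wpM2l => //.
have : (v * a) `^ (alpha - 1) <= x `^ (alpha - 1).
  by apply: ge0_ler_powR; rewrite ?nnegrE ?mulr_ge0//; [lra|exact: ltW].
apply: le_trans; rewrite powRM// -/q ler_wpM2l//.
have [->|an0] := eqVneq a 0; first exact: powR_ge0.
by apply: ger1_powR; [rewrite lt0r an0 a0 a1|lra].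
Qed.

Lemma conjugate_exponentE (R : realType) (alpha beta : R) : 1 < alpha ->
  alpha^-1 + beta^-1 = 1 -> beta = alpha * (alpha - 1)^-1.
Proof.
move=> al2 ab; have al0 : alpha != 0 by rewrite gt_eqF//; lra.
have -> : beta = (1 - alpha^-1)^-1 by rewrite -ab addrC addKr invrK.
by field; apply/andP; split => //; rewrite gt_eqF//; lra.
Qed.

(** For [alpha >= 2] a coefficient [a] is absorbed by a change of scale, so that
    it suffices to treat [a = 1]. *)
Lemma powR_rescale (R : realType) (alpha beta a v : R) : 1 < alpha ->
  alpha^-1 + beta^-1 = 1 -> 0 <= a -> 0 <= v ->
  let w := v * a `^ (alpha - 1)^-1 in
  w `^ (alpha - 1) = v `^ (alpha - 1) * a /\
  w `^ alpha = v `^ alpha * a `^ beta.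
Proof.
move=> al1 ab a0 v0 w; rewrite /w !powRM ?powR_ge0// -!powRrM.
rewrite (conjugate_exponentE al1 ab) mulVf ?powRr1//; last first.
  by rewrite gt_eqF//; lra.
by rewrite [_^-1 * alpha]mulrC.
Qed.

Lemma young_powR (R : realType) (alpha w x : R) : 1 <= alpha ->
  0 <= w -> 0 <= x -> w `^ (alpha - 1) * x <= x `^ alpha + w `^ alpha.
Proof.
move=> al1 w0 x0; have al0 : 0 < alpha by lra.
have [xw|wx] := leP x w.
  rewrite -(mulr_powRB1 w0 al0) (@le_trans _ _ (w * w `^ (alpha - 1)))//.
    by rewrite mulrC ler_wpM2r// powR_ge0.
  by rewrite lerDr powR_ge0.
rewrite -(mulr_powRB1 x0 al0) (@le_trans _ _ (x * x `^ (alpha - 1)))//.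
  rewrite mulrC ler_wpM2l//; apply: ge0_ler_powR; rewrite ?nnegrE//; first lra.
  exact: ltW.
by rewrite lerDl powR_ge0.
Qed.

(** This is where [alpha >= 2] enters: [w `^ (2 * (alpha - 1)) <= w `^ alpha]
    for [w <= 1]. *)
Lemma minr_sqr_powR (R : realType) (alpha w : R) : 2 <= alpha -> 0 <= w ->
  Num.min ((w `^ (alpha - 1)) ^+ 2) 1 <= w `^ alpha.
Proof.
move=> al2 w0; rewrite ge_min; have [w1|w1] := leP w 1; last first.
  apply/orP; right; rewrite -(powRr0 w); apply: ler_powR; first exact: ltW.
  by lra.
apply/orP; left; move: w0; rewrite le_eqVlt => /predU1P[<-|w0].
  by rewrite powR0 ?expr0n ?powR_ge0//= gt_eqF//; lra.
rewrite -powR_mulrn ?powR_ge0// -powRrM; apply: ger_powR; first exact/andP.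
by lra.
Qed.

(** * Expectation of a product of functions of independent variables *)

Section ProductRule.
Context d (T : measurableType d) (R : realType) (P : probability T R).
Import HBNNSimple.

(** The condition on [Z] says that it is uncorrelated with every event
    [X \in B]; approximating [f] from below by simple functions extends it from
    indicators to [f]. *)
Lemma ge0_integral_mul_comp (Z : T -> R) (X : {RV P >-> R}) (c : R)
    (f : R -> R) :
  measurable_fun setT Z -> (forall w, 0 <= Z w) -> 0 <= c ->
  (forall B, measurable B ->
    (\int[P]_w (Z w * \1_B (X w))%:E = c%:E * P (X @^-1` B))%E) ->
  measurable_fun setT f -> (forall x, 0 <= f x) ->
  (\int[P]_w (Z w * f (X w))%:E = c%:E * \int[P]_w (f (X w))%:E)%E.
Proof.
move=> mZ Z0 c0 ZB mf f0.
have mX : measurable_fun setT X by [].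
have mfX (g : R -> R) : measurable_fun setT g ->
    measurable_fun setT (EFin \o (g \o X)).
  by move=> mg; apply/measurable_EFinP; exact: measurableT_comp.
have mZfX (g : R -> R) : measurable_fun setT g ->
    measurable_fun setT (fun w => (Z w * g (X w))%:E).
  move=> mg; apply/measurable_EFinP; apply: measurable_funM => //.
  exact: measurableT_comp.
have step (h : {nnsfun R >-> R}) :
    (\int[P]_w (Z w * h (X w))%:E = c%:E * \int[P]_w (h (X w))%:E)%E.
  have hE := fimfunEord h; move: hE => /=.
  set s := finmap.enum_fset _ => hE.
  have y0 (i : 'I_(size s)) : 0 <= s`_i.
    have : s`_i \in fset_set (range h) by exact: mem_nth.
    by rewrite in_fset_set// => /set_mem[x _ <-].
  pose chi (i : 'I_(size s)) : R -> R := \1_(h @^-1` [set s`_i]).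
  have mI i : measurable_fun setT (chi i) by exact: measurable_indic.
  have chi0 i x : 0 <= chi i x by rewrite /chi indicE.
  transitivity (\sum_(i < size s)
      (s`_i)%:E * \int[P]_w (Z w * chi i (X w))%:E)%E.
    apply: esym; rewrite (eq_bigr (fun i : 'I__ =>
        \int[P]_w ((s`_i)%:E * (Z w * chi i (X w))%:E))%E).
      rewrite -ge0_integral_sum//.
      - apply: esym; apply: eq_integral => w _; rewrite hE mulr_sumr -sumEFin.
        by apply: eq_bigr => i _; rewrite mulrCA.
      - by move=> i; apply: measurable_funeM; exact: mZfX.
      - by move=> i w _; rewrite -EFinM lee_fin !mulr_ge0.
    move=> i _; rewrite ge0_integralZl_EFin// => [w _|]; last exact: mZfX.
    by rewrite lee_fin mulr_ge0.
  transitivity (c%:E * \sum_(i < size s)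
      (s`_i)%:E * \int[P]_w (chi i (X w))%:E)%E.
    rewrite ge0_sume_distrr; last first.
      move=> i _; rewrite mule_ge0 ?lee_fin//; apply: integral_ge0 => w _.
      by rewrite lee_fin.
    apply: eq_bigr => i _; rewrite muleCA ZB//; congr (_ * (_ * _))%E.
    rewrite -[RHS]/(\int[P]_w (\1_(X @^-1` (h @^-1` [set s`_i])) w)%:E)%E.
    by rewrite integral_indic ?setIT// -[X in measurable X]setTI; exact: mX.
  congr (_ * _)%E.
  rewrite (eq_bigr (fun i : 'I__ =>
      \int[P]_w ((s`_i)%:E * (chi i (X w))%:E))%E).
    rewrite -ge0_integral_sum//.
    - apply: eq_integral => w _; rewrite hE -sumEFin.
      by apply: eq_bigr => i _.
    - by move=> i; apply: measurable_funeM; exact: (mfX _ (mI i)).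
    - by move=> i w _; rewrite -EFinM lee_fin !mulr_ge0.
  move=> i _; rewrite ge0_integralZl_EFin// => [w _|].
    by rewrite lee_fin chi0.
  exact: (mfX _ (mI i)).
have mf' : measurable_fun setT (EFin \o f) by exact/measurable_EFinP.
pose f_ := nnsfun_approx measurableT mf'.
have f_cvg x : EFin \o f_^~ x @ \oo --> (f x)%:E.
  have f0' y : setT y -> (0 <= (EFin \o f) y)%E by rewrite lee_fin.
  exact: (cvg_nnsfun_approx measurableT mf' f0').
have f_nd x : {homo f_^~ x : m n / (m <= n)%N >-> m <= n}.
  by move=> m n mn; exact/lefP/nd_nnsfun_approx.
have -> : (\int[P]_w (f (X w))%:E =
    limn (fun n => \int[P]_w (f_ n (X w))%:E))%E.
  rewrite -monotone_convergence//=.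
  - by apply: eq_integral => w _; apply/esym/cvg_lim => //; exact: f_cvg.
  - by move=> n; exact: mfX.
  - by move=> n w _; rewrite lee_fin.
  - by move=> w _ m n mn; rewrite lee_fin; exact: f_nd.
have -> : (\int[P]_w (Z w * f (X w))%:E =
    limn (fun n => \int[P]_w (Z w * f_ n (X w))%:E))%E.
  rewrite -monotone_convergence//=.
  - apply: eq_integral => w _; apply/esym/cvg_lim => //.
    under eq_fun do rewrite EFinM; rewrite EFinM.
    by apply: cvgeZl => //; exact: f_cvg.
  - by move=> n; exact: mZfX.
  - by move=> n w _; rewrite lee_fin mulr_ge0.
  - by move=> w _ m n mn; rewrite lee_fin ler_wpM2l//; exact: f_nd.
rewrite -limeMl//; first by under eq_fun do rewrite step.
apply/ereal_nondecreasing_is_cvgn => a b ab; apply: ge0_le_integral => //.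
- by move=> w _; rewrite lee_fin.
- exact: mfX.
- exact: mfX.
- by move=> w _; rewrite lee_fin; exact: f_nd.
Qed.

Lemma measurable_prod_comp (I : Type) (s : seq I) (Q : pred I)
    (X : I -> {RV P >-> R}) (g : I -> R -> R) :
  (forall i, measurable_fun setT (g i)) ->
  measurable_fun setT (fun w => \prod_(i <- s | Q i) g i (X i w)).
Proof.
move=> mg; elim: s => [|i s IH].
  by under eq_fun do rewrite big_nil; exact: measurable_cst.
have [Qi|/negPf Qi] := boolP (Q i);
  under eq_fun do rewrite big_cons Qi; last first.
  exact: IH.
by apply: measurable_funM => //; exact: measurableT_comp.
Qed.

(** If all [g i] are indicators this is the product rule for sets; by induction
    on a list [s] containing every [i] for which [g i] is not an indicator, the
    indicators are exchanged for general functions one at a time. *)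
Lemma independent_integral_prod (I : finType) (X : I -> {RV P >-> R})
    (g : I -> R -> R) (e : I -> R) :
  mutually_independent X ->
  (forall i, measurable_fun setT (g i)) -> (forall i x, 0 <= g i x) ->
  (forall i, \int[P]_w (g i (X i w))%:E = (e i)%:E)%E ->
  (\int[P]_w (\prod_i g i (X i w))%:E = (\prod_i e i)%:E)%E.
Proof.
move=> indep.
suff main (s : seq I) : forall (g : I -> R -> R) (e : I -> R),
    (forall i, measurable_fun setT (g i)) -> (forall i x, 0 <= g i x) ->
    (forall i, \int[P]_w (g i (X i w))%:E = (e i)%:E)%E ->
    (forall i, i \notin s -> exists2 B, measurable B & g i = \1_B) ->
    (\int[P]_w (\prod_i g i (X i w))%:E = (\prod_i e i)%:E)%E.
  move=> mg g0 ge; apply: (main (enum I)) => // i.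
  by rewrite mem_enum.
elim: s => [|i0 s IH] {}g {}e mg g0 ge gB.
  have /choice[B mB] : forall i, exists B, measurable B /\ g i = \1_B.
    by move=> i; have [//|B mB ->] := gB i; exists B.
  have mXB i : measurable (X i @^-1` B i).
    rewrite -[X in measurable X]setTI; apply: measurable_funP => //.
    exact: (mB i).1.
  have := indep [set: I]%SET B (fun i _ => (mB i).1).
  have -> : [set` [set: I]%SET] = [set: I].
    by apply/seteqP; split => i //= _; rewrite inE.
  move=> PB.
  transitivity (\int[P]_w (\1_(\bigcap_i (X i @^-1` B i)) w)%:E)%E.
    apply: eq_integral => w _; congr EFin.
    under eq_bigr do rewrite (mB _).2.
    rewrite indicE; have [/set_mem wB|wB] := boolP (w \in _).
      by rewrite big1// => i _; rewrite indicE mem_set//; exact: wB.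
    have /existsNP[i /not_implyP[_ wi]] :
        ~ (forall i, setT i -> (X i @^-1` B i) w).
      by move=> h; move/negP: wB; apply; exact/mem_set.
    by rewrite (bigD1 i)//= indicE memNset// mul0r.
  rewrite integral_indic ?setIT//; last by apply: fin_bigcap_measurable.
  apply: (etrans PB); rewrite -prodEFin.
  apply: eq_big => [i|i _]; first by rewrite inE.
  rewrite -ge (mB i).2.
  rewrite -[RHS]/(\int[P]_w (\1_(X i @^-1` B i) w)%:E)%E.
  by rewrite integral_indic ?setIT.
rewrite (bigD1 i0)//= mulrC EFinM -ge.
under eq_integral do rewrite (bigD1 i0)//= mulrC.
have e0 i : 0 <= e i.
  by rewrite -lee_fin -ge; apply: integral_ge0 => w _; rewrite lee_fin.
apply: (@ge0_integral_mul_comp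
  (fun w => \prod_(i | i != i0) g i (X i w)) (X i0)) => //.
- exact: measurable_prod_comp.
- by move=> w; apply: prodr_ge0.
- by apply: prodr_ge0.
- move=> B mB.
  have mXB : measurable (X i0 @^-1` B).
    by rewrite -[X in measurable X]setTI; apply: measurable_funP.
  have := IH (fun i => if i == i0 then \1_B else g i)
    (fun i => if i == i0 then fine (P (X i0 @^-1` B)) else e i).
  rewrite (bigD1 i0)//= eqxx (eq_bigr e) => [|i /negPf->//].
  rewrite mulrC EFinM fineK ?fin_num_measure// => <-.
  + apply: eq_integral => w _; congr EFin.
    rewrite [RHS](bigD1 i0)//= eqxx mulrC; congr (_ * _).
    by apply: eq_bigr => i /negPf->.
  + by move=> i; case: eqP => // _; exact: measurable_indic.
  + by move=> i x; case: eqP => // _; rewrite indicE.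
  + move=> i; case: eqP => [->|_]; last exact: ge.
    rewrite fineK ?fin_num_measure//.
    rewrite -[LHS]/(\int[P]_w (\1_(X i0 @^-1` B) w)%:E)%E.
    by rewrite integral_indic ?setIT.
  + move=> i si; case: eqP => [_|/eqP ii0]; first by exists B.
    by apply: gB; rewrite inE negb_or ii0.
Qed.

End ProductRule.

(** * Exponential moments of one variable *)

Section Moments.
Context d (T : measurableType d) (R : realType) (P : probability T R).
Implicit Types X Y : T -> R.

Lemma ge0_expectation_le X Y : measurable_fun setT X -> measurable_fun setT Y ->
  (forall w, 0 <= X w) -> (forall w, X w <= Y w) -> ('E_P[X] <= 'E_P[Y])%E.
Proof.
move=> mX mY X0 XY; apply: expectation_le => //.
  by move=> w; exact: le_trans (XY w).
exact: aeW.
Qed.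

Lemma ge0_expectationZl X (k : R) : measurable_fun setT X ->
  (forall w, 0 <= X w) -> 0 <= k ->
  ('E_P[fun w => (k * X w)%R] = k%:E * 'E_P[X])%E.
Proof.
move=> mX X0 k0; rewrite unlock; under eq_integral do rewrite EFinM.
rewrite ge0_integralZl_EFin// => [w _|]; first by rewrite lee_fin.
exact/measurable_EFinP.
Qed.

Lemma ge0_expectationD X Y : measurable_fun setT X -> measurable_fun setT Y ->
  (forall w, 0 <= X w) -> (forall w, 0 <= Y w) ->
  ('E_P[fun w => (X w + Y w)%R] = 'E_P[X] + 'E_P[Y])%E.
Proof.
move=> mX mY X0 Y0; rewrite unlock; under eq_integral do rewrite EFinD.
by rewrite ge0_integralD//; do ?[by move=> w _; rewrite lee_fin];
  exact/measurable_EFinP.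
Qed.

Lemma measurable_expR_comp X : measurable_fun setT X ->
  measurable_fun setT (fun w => expR (X w)).
Proof. by move=> mX; exact: (measurableT_comp (@measurable_expR R)). Qed.

Lemma measurable_normr_comp X : measurable_fun setT X ->
  measurable_fun setT (fun w => `|X w|).
Proof. exact: (measurableT_comp (@normr_measurable R setT)). Qed.

Lemma measurable_normr_powR X (p : R) : measurable_fun setT X ->
  measurable_fun setT (fun w => `|X w| `^ p).
Proof.
move=> mX; apply: (measurableT_comp (measurable_powR p)).
exact: measurable_normr_comp.
Qed.

(** An exponential moment is brought below 2 by dividing the exponent,
    because [expR] is convex and equals 1 at 0. *)
Lemma expectation_expR_div X (M : R) : measurable_fun setT X -> 1 <= M ->
  ('E_P[fun w => expR (X w)] <= M%:E)%E ->
  ('E_P[fun w => expR (X w / M)] <= 2%:E)%E.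
Proof.
move=> mX M1 XM; have M0 : 0 < M by lra.
have meX : measurable_fun setT (fun w => expR (X w)).
  exact: measurable_expR_comp.
apply: (@le_trans _ _ ('E_P[fun w => (1 + M^-1 * expR (X w))%R])%E).
  apply: ge0_expectation_le => [||w|w].
  - apply: measurable_expR_comp; exact: measurable_funM.
  - by apply: measurable_funD => //; exact: measurable_funM.
  - exact: expR_ge0.
  - exact: expR_div_le.
rewrite ge0_expectationD//; last 2 first.
- exact: measurable_funM.
- by move=> w; rewrite mulr_ge0 ?invr_ge0 ?expR_ge0// ltW.
rewrite -[X in ('E_P[X] + _)%E]/(cst 1) expectation_cst.
have -> : 2%:E = (1 + M^-1%:E * M%:E)%E :> \bar R.
  by rewrite -EFinM -EFinD mulVf ?gt_eqF.
have Mi0 : 0 <= M^-1 by rewrite invr_ge0 ltW.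
rewrite leeD2l// ge0_expectationZl//.
by apply: lee_wpmul2l; rewrite // lee_fin.
Qed.

Lemma expectation_expR_powR_le Y (p q : R) : measurable_fun setT Y ->
  0 < p -> p <= q ->
  ('E_P[fun w => expR (`|Y w| `^ q)] <= 2%:E)%E ->
  ('E_P[fun w => expR (`|Y w| `^ p)] <= (2 * expR 1)%:E)%E.
Proof.
move=> mY p0 pq Yq; rewrite mulrC EFinM.
apply: (@le_trans _ _ ('E_P[fun w => (expR 1 * expR (`|Y w| `^ q))%R])%E).
  apply: ge0_expectation_le => [||w|w].
  - exact/measurable_expR_comp/measurable_normr_powR.
  - apply: measurable_funM => //.
    exact/measurable_expR_comp/measurable_normr_powR.
  - exact: expR_ge0.
  - by rewrite -expRD ler_expR ler_1DpowR.
rewrite ge0_expectationZl ?expR_ge0//; last first.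
  exact/measurable_expR_comp/measurable_normr_powR.
by apply: lee_wpmul2l => //; rewrite lee_fin expR_ge0.
Qed.

Lemma expR_normr_integrable Y (G : R) : measurable_fun setT Y ->
  ('E_P[fun w => expR `|Y w|] <= G%:E)%E ->
  P.-integrable setT (EFin \o (fun w => expR `|Y w|)) /\
  P.-integrable setT (EFin \o Y).
Proof.
move=> mY YG.
have mN : measurable_fun setT (fun w => `|Y w|).
  exact: measurable_normr_comp.
have mE : measurable_fun setT (fun w => expR `|Y w|).
  exact: measurable_expR_comp.
have iE : P.-integrable setT (EFin \o (fun w => expR `|Y w|)).
  apply/integrableP; split; first exact/measurable_EFinP.
  apply: le_lt_trans (ltry G); move: YG; rewrite unlock; apply: le_trans.
  by rewrite le_eqVlt; apply/orP; left; apply/eqP; apply: eq_integral => w _ /=;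
    rewrite ger0_norm ?expR_ge0.
have iY : P.-integrable setT (EFin \o Y).
  apply: le_integrable iE => //; first exact/measurable_EFinP.
  move=> w _ /=; rewrite lee_fin [leRHS]ger0_norm ?expR_ge0//.
  by apply: le_trans (expR_ge1Dx _); rewrite lerDr.
by [].
Qed.

(** Centering removes the linear term, so that the logarithm is of order
    [t ^+ 2] for small [t]. *)
Lemma expectation_expR_centered Y (t : R) (G : R) : measurable_fun setT Y ->
  ('E_P[Y] = 0)%E -> ('E_P[fun w => expR `|Y w|] <= G%:E)%E ->
  `|t| <= 2^-1 ->
  ('E_P[fun w => expR (t * Y w)] <= (1 + 8 * t ^+ 2 * G)%:E)%E.
Proof.
move=> mY Y0 YG t2.
have mN : measurable_fun setT (fun w => `|Y w|).
  exact: measurable_normr_comp.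
have mE : measurable_fun setT (fun w => expR `|Y w|).
  exact: measurable_expR_comp.
have [iE iY] := expR_normr_integrable mY YG.
apply: (@le_trans _ _
  ('E_P[fun w => (1 + t * Y w + 8 * t ^+ 2 * expR `|Y w|)%R])%E).
  apply: ge0_expectation_le => [||w|w].
  - by apply: measurable_expR_comp; exact: measurable_funM.
  - apply: measurable_funD; last exact: measurable_funM.
    by apply: measurable_funD => //; exact: measurable_funM.
  - exact: expR_ge0.
  - exact: expR_scale_le.
move: Y0 YG; rewrite unlock => Y0 YG.
have i1 : P.-integrable setT (EFin \o (cst 1 : T -> R)).
  exact: finite_measure_integrable_cst.
have itY : P.-integrable setT (EFin \o (fun w => t * Y w)).
  exact: (integrableZl measurableT t iY).
have icE : P.-integrable setT (EFin \o (fun w => 8 * t ^+ 2 * expR `|Y w|)).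
  exact: (integrableZl measurableT (8 * t ^+ 2) iE).
rewrite (integralD_EFin measurableT (f1 := fun w => 1 + t * Y w))//; last first.
  exact: (integrableD measurableT i1 itY).
rewrite (integralD_EFin measurableT i1 itY).
have -> : (\int[P]_x (EFin \o (fun w => t * Y w)%R) x = 0)%E.
  by rewrite (integralZl measurableT iY) Y0 mule0.
have -> : (\int[P]_x (EFin \o cst 1%R) x = 1)%E.
  rewrite -[LHS]/(\int[P]_x (cst 1%:E) x)%E.
  by rewrite integral_cst//= probability_setT mule1.
rewrite (integralZl measurableT iE) adde0 EFinD leeD2l// [leRHS]EFinM.
by apply: lee_wpmul2l => //; rewrite lee_fin mulr_ge0// sqr_ge0.
Qed.

(** For [`|t| <= 2^-1] the quadratic bound applies; for larger [t] the Young
    inequality gives [2 * expR b], and the factor 2 is absorbed because then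
    [b >= 4^-1]. *)
Lemma mgf_le Y (alpha b t : R) : measurable_fun setT Y -> 1 <= alpha ->
  ('E_P[Y] = 0)%E ->
  ('E_P[fun w => expR (`|Y w| `^ alpha)] <= 2%:E)%E ->
  (forall x, 0 <= x -> `|t| * x <= x `^ alpha + b) ->
  Num.min (`|t| ^+ 2) 1 <= b ->
  ('E_P[fun w => expR (t * Y w)] <= (expR (16 * expR 1 * b))%:E)%E.
Proof.
move=> mY al1 Y0 Yal young tb.
have e1 : 1 + 1 <= expR 1 :> R := expR_ge1Dx 1.
have [t2|t2] := leP `|t| 2^-1.
  have t1 : t ^+ 2 <= b.
    have t0 := normr_ge0 t; rewrite -real_normK ?num_real//; apply: le_trans tb.
    by rewrite le_min lexx/=; nra.
  have YG := expectation_expR_powR_le mY ltr01 al1 Yal.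
  apply: le_trans (@expectation_expR_centered Y t (2 * expR 1) mY Y0 _ t2) _.
    by under eq_fun do rewrite -[X in expR X]powRr1//.
  rewrite lee_fin; apply: le_trans (expR_ge1Dx _); rewrite lerD2l.
  rewrite (_ : 8 * _ * _ = 16 * expR 1 * t ^+ 2); last by ring.
  by rewrite ler_wpM2l// mulr_ge0// expR_ge0.
have b4 : 4^-1 <= b.
  by apply: le_trans tb; rewrite le_min; apply/andP; split; nra.
apply: (@le_trans _ _ ('E_P[fun w => (expR b * expR (`|Y w| `^ alpha))%R])%E).
  apply: ge0_expectation_le => [||w|w].
  - by apply: measurable_expR_comp; exact: measurable_funM.
  - apply: measurable_funM => //.
    exact/measurable_expR_comp/measurable_normr_powR.
  - exact: expR_ge0.
  - rewrite -expRD ler_expR (le_trans (ler_norm _))// normrM addrC.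
    exact: young.
rewrite ge0_expectationZl ?expR_ge0//; last first.
  exact/measurable_expR_comp/measurable_normr_powR.
apply: (@le_trans _ _ ((expR b)%:E * 2%:E)%E).
  by apply: lee_wpmul2l => //; rewrite lee_fin expR_ge0.
rewrite -EFinM lee_fin (@le_trans _ _ (expR (b + 1)))//.
  by rewrite expRD ler_wpM2l ?expR_ge0//; lra.
by rewrite ler_expR; nra.
Qed.

End Moments.

(** * From the moment generating function to an exponential moment *)

Section OrliczFromMgf.
Context d (T : measurableType d) (R : realType) (P : probability T R).

Lemma nneseries_geometric_le (u : (\bar R)^nat) (c : R) :
  (forall k, 0 <= u k)%E -> (forall k, u k <= (c * 2^-1 ^+ k)%:E)%E ->
  (\sum_(k <oo) u k <= (2 * c)%:E)%E.
Proof.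
move=> u0 uc; apply: lime_le; first exact: is_cvg_nneseries.
apply: nearW => n; apply: (@le_trans _ _ (2 * c - 2 * c * 2^-1 ^+ n)%:E).
  rewrite big_mkord; elim: n => [|n IH].
    by rewrite big_ord0 expr0 mulr1 subrr.
  rewrite big_ord_recr/=; apply: (le_trans (leeD IH (uc n))).
  by rewrite -EFinD lee_fin exprS; lra.
have c0 : 0 <= c by have := le_trans (u0 0) (uc 0); rewrite lee_fin expr0 mulr1.
by rewrite lee_fin gerBl !mulr_ge0.
Qed.

(** Chernoff at the levels [k.+1] of [Y = (`|S| / (3 * K)) `^ alpha]:
    on [Y >= k.+1] with [v = k.+1 `^ alpha^-1] one has
    [v `^ (alpha - 1) * `|S| >= 3 * K * k.+1], which beats the bound
    [2 * expR (K * k.+1)] by enough to sum [expR k.+2] over the levels. *)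
Lemma expectation_expR_of_mgf (S : T -> R) (alpha K : R) :
  measurable_fun setT S -> 1 <= alpha -> 1 <= K ->
  (forall v, 1 <= v -> ('E_P[fun w => expR (v `^ (alpha - 1) * `|S w|)%R] <=
    (2 * expR (K * v `^ alpha))%:E)%E) ->
  ('E_P[fun w => expR ((`|S w| / (3 * K)) `^ alpha)%R] <= (expR 1 + 4)%:E)%E.
Proof.
move=> mS al1 K1 mgf; have al0 : 0 < alpha by lra.
have K3 : 0 < 3 * K by lra.
pose v k : R := k.+1%:R `^ alpha^-1.
have v_al k : v k `^ alpha = k.+1%:R by rewrite -powRrM mulVf ?gt_eqF// powRr1.
have v0 k : 0 < v k by rewrite powR_gt0.
have v1 k : 1 <= v k.
  by rewrite -(powRr0 k.+1%:R) ler_powR ?invr_ge0 ?(ltW al0)// ler1n.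
pose F k w :=
  expR (k.+2%:R - 3 * K * k.+1%:R) * expR (v k `^ (alpha - 1) * `|S w|).
have mN : measurable_fun setT (fun w => `|S w|).
  exact: measurable_normr_comp.
have mvS k : measurable_fun setT (fun w => expR (v k `^ (alpha - 1) * `|S w|)).
  by apply: measurable_expR_comp; exact: measurable_funM.
have mF k : measurable_fun setT (F k) by exact: measurable_funM.
have F0 k w : 0 <= F k w by rewrite mulr_ge0 ?expR_ge0.
have EF k : ('E_P[F k] <= (2 * 2^-1 ^+ k)%:E)%E.
  rewrite ge0_expectationZl ?expR_ge0//.
  apply: le_trans.
    by apply: lee_wpmul2l (mgf _ (v1 k)); rewrite lee_fin expR_ge0.
  rewrite -EFinM lee_fin v_al mulrCA ler_wpM2l// -expRD.
  have k0 : 0 <= k%:R :> R by [].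
  apply: (@le_trans _ _ (expR (k%:R * (-1)))).
    by rewrite ler_expR -!natr1; nra.
  rewrite expRM_natl lerXn2r ?nnegrE ?expR_ge0//.
  by rewrite expRN lef_pV2 ?posrE ?expR_gt0// expR_ge1Dx.
have YF w : ((expR ((`|S w| / (3 * K)) `^ alpha))%:E <=
    (expR 1)%:E + \sum_(k <oo) (F k w)%:E)%E.
  set y := _ `^ _.
  have sF0 : (0 <= \sum_(k <oo) (F k w)%:E)%E.
    by apply: nneseries_ge0 => k _ _; rewrite lee_fin.
  have [y1|y1] := leP y 1.
    by apply: (@le_trans _ _ (expR 1)%:E);
      [rewrite lee_fin ler_expR|rewrite leeDl].
  have y0 : 0 <= y by lra.
  have /andP[my ym] := truncn_itv y0.
  have : (0 < Num.truncn y)%N.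
    by rewrite lt0n; apply/eqP => t0; move: ym; rewrite t0; lra.
  move: (Num.truncn y) my ym => [//|k] ky yk _.
  apply: (@le_trans _ _ (F k w)%:E).
    rewrite lee_fin /F -expRD ler_expR.
    suff : 3 * K * k.+1%:R <= v k `^ (alpha - 1) * `|S w| by lra.
    have vS : 3 * K * v k <= `|S w|.
      rewrite mulrC -ler_pdivlMr// leNgt; apply/negP => Sv.
      have : y < k.+1%:R.
        rewrite -(v_al k); apply: gt0_ltr_powR; rewrite ?nnegrE ?divr_ge0//;
          exact: ltW.
      by rewrite ltNge ky.
    rewrite -(v_al k) -(mulr_powRB1 (ltW (v0 k)) al0) mulrA mulrC.
    by rewrite ler_wpM2l ?powR_ge0.
  apply: (@le_trans _ _ (\sum_(k <oo) (F k w)%:E)%E).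
    apply: le_trans (nneseries_lim_ge k.+1 _); last first.
      by move=> i _ _; rewrite lee_fin.
    by rewrite big_nat_recr//= leeDr// sume_ge0// => i _; rewrite lee_fin.
  by rewrite leeDr// lee_fin expR_ge0.
rewrite unlock.
have mEF k : measurable_fun setT (fun w => (F k w)%:E).
  exact/measurable_EFinP.
have msF : measurable_fun setT (fun w => \sum_(k <oo) (F k w)%:E)%E.
  by apply: ge0_emeasurable_sum => // k w _ _; rewrite lee_fin.
apply: (@le_trans _ _ (\int[P]_w ((expR 1)%:E + \sum_(k <oo) (F k w)%:E))%E).
  apply: ge0_le_integral => //.
  - apply/measurable_EFinP/measurable_expR_comp.
    apply: (measurableT_comp (measurable_powR alpha)).
    exact: measurable_funM.
  - exact: emeasurable_funD.
rewrite ge0_integralD//; last first.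
  by move=> w _; apply: nneseries_ge0 => k _ _; rewrite lee_fin.
have -> : (\int[P]_w (expR 1)%:E = (expR 1)%:E)%E.
  by have := @expectation_cst _ _ _ P (expR 1); rewrite unlock.
rewrite EFinD leeD2l// integral_nneseries//; last first.
  by move=> k w _; rewrite lee_fin.
have -> : (4 = 2 * 2 :> R) by ring.
apply: nneseries_geometric_le => k.
  by apply: integral_ge0 => w _; rewrite lee_fin.
by have := EF k; rewrite unlock.
Qed.

Lemma orlicz_of_mgf (S : T -> R) (alpha K : R) :
  measurable_fun setT S -> 1 <= alpha -> 1 <= K ->
  (forall v, 1 <= v -> ('E_P[fun w => expR (v `^ (alpha - 1) * `|S w|)%R] <=
    (2 * expR (K * v `^ alpha))%:E)%E) ->
  ('E_P[fun w => expR ((`|S w| / (3 * K * (expR 1 + 4))) `^ alpha)%R]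
    <= 2%:E)%E.
Proof.
move=> mS al1 K1 mgf; have al0 : 0 < alpha by lra.
have e0 := expR_gt0 (1 : R); set M := expR 1 + 4.
have M1 : 1 <= M by rewrite /M; lra.
have mD (c : R) : measurable_fun setT (fun w => (`|S w| / c) `^ alpha).
  apply: (measurableT_comp (measurable_powR alpha)).
  by apply: measurable_funM => //; exact: measurable_normr_comp.
apply: le_trans (expectation_expR_div (mD (3 * K)) M1
  (expectation_expR_of_mgf mS al1 K1 mgf)).
apply: ge0_expectation_le => [||w|w].
- exact: measurable_expR_comp.
- by apply: measurable_expR_comp; exact: measurable_funM.
- exact: expR_ge0.
have S0 : 0 <= `|S w| / (3 * K) by rewrite divr_ge0//; lra.
have -> : `|S w| / (3 * K * M) = `|S w| / (3 * K) * M^-1.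
  by field; apply/andP; split; rewrite gt_eqF//; lra.
rewrite ler_expR powRM ?invr_ge0//; last lra.
rewrite ler_wpM2l ?powR_ge0//; apply: ge1r_powR => //.
by rewrite invr_gt0 invf_le1; lra.
Qed.

End OrliczFromMgf.

(** * Weighted sums of independent variables *)

Section SumOfIndependent.
Context d (T : measurableType d) (R : realType) (P : probability T R).
Variables (I : finType) (X : I -> {RV P >-> R}).
Hypothesis indep : mutually_independent X.
Hypothesis centered : forall i, ('E_P[X i] = 0)%E.

Lemma mgf_sum_le (c b : I -> R) (t : R) :
  (forall i, 'E_P[fun w => expR (t * (c i * X i w))%R] <= (expR (b i))%:E)%E ->
  ('E_P[fun w => expR (t * \sum_i c i * X i w)%R] <= (expR (\sum_i b i))%:E)%E.
Proof.
move=> cb.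
have fin i : 'E_P[fun w => expR (t * (c i * X i w))%R]%E \is a fin_num.
  rewrite ge0_fin_numE; first exact: le_lt_trans (cb i) (ltry _).
  by apply: expectation_ge0 => w; exact: expR_ge0.
have -> : (fun w => expR (t * \sum_i c i * X i w)) =
    (fun w => \prod_i (fun x => expR (t * (c i * x))) (X i w)).
  by apply/funext => w; rewrite mulr_sumr expR_sum.
rewrite unlock (independent_integral_prod (g := fun i x => expR (t * (c i * x)))
  (e := fun i => fine ('E_P[fun w => expR (t * (c i * X i w))])%E))//.
- rewrite lee_fin expR_sum; apply: ler_prod => i _.
  rewrite fine_ge0 ?expectation_ge0//=.
  by rewrite -lee_fin fineK.
- move=> i; apply: measurable_expR_comp; exact: measurable_funM.
- by move=> i; rewrite fineK// unlock.
Qed.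

(** By [mgf_le], the two hypotheses on [s = v `^ (alpha - 1) * `|c i|] bound the
    logarithm of the moment generating function of [X i / u i] at [+- s] by a
    multiple of [v `^ alpha * r i]; by independence the weights [r i] add up. *)
Lemma orlicz_sum_of_young (alpha : R) (u c r : I -> R) : 1 <= alpha ->
  (forall i, 'E_P[fun w => expR ((`|X i w| / u i) `^ alpha)%R] <= 2%:E)%E ->
  (forall i, 0 < u i) ->
  \sum_i r i <= 1 ->
  (forall v i x, 1 <= v -> 0 <= x ->
    v `^ (alpha - 1) * `|c i| * x <= x `^ alpha + v `^ alpha * r i) ->
  (forall v i, 1 <= v ->
    Num.min ((v `^ (alpha - 1) * `|c i|) ^+ 2) 1 <= v `^ alpha * r i) ->
  ('E_P[fun w => expR ((`|(\sum_i c i / u i * X i w)%R| /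
    (3 * (16 * expR 1) * (expR 1 + 4))) `^ alpha)%R] <= 2%:E)%E.
Proof.
move=> al1 Xu u0 r1 young small.
have e1 : 1 + 1 <= expR 1 :> R := expR_ge1Dx 1.
have mS : measurable_fun setT (fun w => \sum_i c i / u i * X i w).
  by apply: measurable_sum => i; exact: measurable_funM.
apply: (orlicz_of_mgf mS al1) => [|v v1]; first lra.
set K := 16 * expR 1; set s := v `^ (alpha - 1).
have s0 : 0 <= s by exact: powR_ge0.
have mgf t : `|t| = s ->
    ('E_P[fun w => expR (t * \sum_i c i / u i * X i w)%R] <=
      (expR (K * v `^ alpha))%:E)%E.
  move=> ts; apply: (@le_trans _ _ (expR (\sum_i K * (v `^ alpha * r i)))%:E).
    apply: mgf_sum_le => i.
    have -> : (fun w => expR (t * (c i / u i * X i w))) =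
        (fun w => expR (t * c i * (X i w / u i))).
      by apply/funext => w; congr expR; field; rewrite gt_eqF.
    have mX : measurable_fun setT (fun w => X i w / u i).
      exact: measurable_funM.
    have Xu' : ('E_P[fun w => expR (`|X i w / u i| `^ alpha)%R] <= 2%:E)%E.
      under eq_fun do rewrite normrM [X in (_ * X)%R]gtr0_norm ?invr_gt0//.
      exact: Xu.
    apply: (mgf_le mX al1 _ Xu').
    - rewrite unlock; under eq_integral do rewrite mulrC EFinM.
      have iX : P.-integrable setT (EFin \o X i).
        have := expectation_expR_powR_le mX ltr01 al1 Xu'.
        under eq_fun do rewrite powRr1//.
        move=> /(expR_normr_integrable mX)[_ /(integrableZl measurableT (u i))].
        apply: eq_integrable => // w _ /=; rewrite -EFinM; congr EFin.
        by field; rewrite gt_eqF.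
      rewrite integralZl//.
      by have := centered i; rewrite unlock => ->; rewrite mule0.
    - by move=> x x0; rewrite normrM ts; exact: young.
    - by rewrite normrM ts; exact: small.
  rewrite lee_fin ler_expR -!mulr_sumr ler_wpM2l//; first by rewrite /K; lra.
  by rewrite ler_piMr ?powR_ge0.
have mE t : measurable_fun setT (fun w => expR (t * \sum_i c i / u i * X i w)).
  by apply: measurable_expR_comp; exact: measurable_funM.
apply: (@le_trans _ _ ('E_P[fun w => (expR (s * \sum_i c i / u i * X i w) +
    expR (- s * \sum_i c i / u i * X i w))%R])%E).
  apply: ge0_expectation_le => [||w|w].
  - apply: measurable_expR_comp; apply: measurable_funM => //.
    exact: measurable_normr_comp.
  - exact: measurable_funD.
  - exact: expR_ge0.
  - case: (ger0P (\sum_i c i / u i * X i w)) => _.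
      by rewrite lerDl expR_ge0.
    by rewrite mulrN -mulNr lerDr expR_ge0.
rewrite ge0_expectationD//.
rewrite -[2]/(1 + 1) mulrDl mul1r EFinD; apply: leeD; apply: mgf.
- exact: ger0_norm.
- by rewrite normrN ger0_norm.
Qed.

End SumOfIndependent.

(** The factor lost in [orlicz_of_mgf] for the constant [K = 16 * expR 1] of
    [mgf_le]. *)
Definition orlicz_const (R : realType) : R := 3 * (16 * expR 1) * (expR 1 + 4).

Lemma orlicz_const_gt0 (R : realType) : 0 < orlicz_const R.
Proof. by have := expR_gt0 (1 : R); rewrite /orlicz_const !mulr_gt0//; lra. Qed.

Section WeightedSum.
Context d (T : measurableType d) (R : realType) (P : probability T R).
Variables (I : finType) (X : I -> {RV P >-> R}) (a : I -> R).
Hypothesis indep : mutually_independent X.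
Hypothesis centered : forall i, ('E_P[X i] = 0)%E.

(** The weights [c `^ q] serve both regimes, with [q = 2] and [q = beta]; that
    they sum to at most 1 also yields [c <= 1]. *)
Lemma orlicz_sum_of_powR_weights (alpha q A : R) (u : I -> R) :
  1 <= alpha -> 0 < q -> 0 < A -> (forall i, 0 < u i) ->
  (forall i, 'E_P[fun w => expR ((`|X i w| / u i) `^ alpha)%R] <= 2%:E)%E ->
  \sum_i (`|a i| * u i / A) `^ q <= 1 ->
  (forall v c x, 1 <= v -> 0 <= c <= 1 -> 0 <= x ->
    v `^ (alpha - 1) * c * x <= x `^ alpha + v `^ alpha * c `^ q) ->
  (forall v c, 1 <= v -> 0 <= c <= 1 ->
    Num.min ((v `^ (alpha - 1) * c) ^+ 2) 1 <= v `^ alpha * c `^ q) ->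
  ('E_P[fun w => expR ((`|(\sum_i a i * X i w)%R| /
    (orlicz_const R * A)) `^ alpha)%R] <= 2%:E)%E.
Proof.
move=> al1 q0 A0 u0 Xu sum1 young small.
pose c i := a i * u i / A.
have cE i : `|c i| = `|a i| * u i / A.
  by rewrite /c !normrM (gtr0_norm (u0 i)) [X in _ * X]gtr0_norm ?invr_gt0.
have c1 i : 0 <= `|c i| <= 1.
  rewrite normr_ge0/= leNgt; apply/negP => c1.
  have : 1 < `|c i| `^ q.
    have -> : 1 = 1 `^ q :> R by rewrite powR1.
    by apply: gt0_ltr_powR; rewrite ?nnegrE.
  rewrite ltNge cE => /negP; apply; apply: le_trans sum1.
  by rewrite (bigD1 i)//= lerDl sumr_ge0// => j _; exact: powR_ge0.
have sumc : \sum_i `|c i| `^ q <= 1 by under eq_bigr do rewrite cE.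
have := orlicz_sum_of_young indep centered al1 Xu u0 sumc
  (fun v i x v1 x0 => young v _ x v1 (c1 i) x0)
  (fun v i v1 => small v _ v1 (c1 i)).
congr (_ <= _)%E; congr ('E_P[_])%E; apply/funext => w.
congr (expR (_ `^ _)); rewrite -/(orlicz_const R).
have D0 := orlicz_const_gt0 R.
have -> : \sum_i c i / u i * X i w = (\sum_i a i * X i w) / A.
  rewrite mulr_suml; apply: eq_bigr => i _; rewrite /c; field.
  by rewrite !gt_eqF.
have A0' : 0 < A^-1 by rewrite invr_gt0.
rewrite normrM (gtr0_norm A0'); field.
by rewrite !gt_eqF.
Qed.

Lemma orlicz_sum_subquadratic (alpha A : R) (u : I -> R) :
  1 <= alpha -> alpha <= 2 -> 0 < A -> (forall i, 0 < u i) ->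
  (forall i, 'E_P[fun w => expR ((`|X i w| / u i) `^ alpha)%R] <= 2%:E)%E ->
  \sum_i (`|a i| * u i / A) `^ 2 <= 1 ->
  ('E_P[fun w => expR ((`|(\sum_i a i * X i w)%R| /
    (orlicz_const R * A)) `^ alpha)%R] <= 2%:E)%E.
Proof.
move=> al1 al2 A0 u0 Xu sum1.
apply: (@orlicz_sum_of_powR_weights alpha 2 A u) => // v c.
  by move=> x v1 c01 x0; apply: young_subquadratic => //; lra.
move=> v1 /andP[c0 c1]; rewrite ge_min; apply/orP; left.
rewrite exprMn -(powR_mulrn _ (powR_ge0 _ _)) -powRrM.
rewrite -[2]/(2%:R) (powR_mulrn 2 c0).
rewrite ler_wpM2r ?sqr_ge0//; apply: ler_powR => //; lra.
Qed.

Lemma orlicz_sum_superquadratic (alpha beta A : R) (u : I -> R) :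
  2 <= alpha -> alpha^-1 + beta^-1 = 1 -> 0 < A -> (forall i, 0 < u i) ->
  (forall i, 'E_P[fun w => expR ((`|X i w| / u i) `^ alpha)%R] <= 2%:E)%E ->
  \sum_i (`|a i| * u i / A) `^ beta <= 1 ->
  ('E_P[fun w => expR ((`|(\sum_i a i * X i w)%R| /
    (orlicz_const R * A)) `^ alpha)%R] <= 2%:E)%E.
Proof.
move=> al2 ab A0 u0 Xu sum1.
have al1 : 1 < alpha by lra.
have beta0 : 0 < beta.
  by rewrite (conjugate_exponentE al1 ab) divr_gt0//; lra.
apply: (@orlicz_sum_of_powR_weights alpha beta A u) => //; first exact: ltW.
- move=> v c x v1 /andP[c0 _] x0.
  have v0 : 0 <= v by lra.
  have [<- <-] := powR_rescale al1 ab c0 v0.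
  by apply: young_powR => //; [exact: ltW|rewrite mulr_ge0 ?powR_ge0].
- move=> v c v1 /andP[c0 _].
  have v0 : 0 <= v by lra.
  have [<- <-] := powR_rescale al1 ab c0 v0.
  by apply: minr_sqr_powR => //; rewrite mulr_ge0 ?powR_ge0.
Qed.

End WeightedSum.

(** * Orlicz norms *)

Section OrliczNorm.
Context d (T : measurableType d) (R : realType) (P : probability T R).

Lemma orlicz_norm_ge0 (alpha : R) (X : T -> R) : (0 <= orlicz_norm P alpha X)%E.
Proof.
by apply: le_ereal_inf_tmp => _ [u [u0 _] <-]; rewrite lee_fin ltW.
Qed.

Lemma orlicz_norm_le (alpha u : R) (X : T -> R) : 0 < u ->
  ('E_P[fun w => expR ((`|X w| / u) `^ alpha)%R] <= 2%:E)%E ->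
  (orlicz_norm P alpha X <= u%:E)%E.
Proof. by move=> u0 Xu; apply: ereal_inf_lbound; exists u. Qed.

Lemma orlicz_norm_lt (alpha u : R) (X : T -> R) : measurable_fun setT X ->
  0 <= alpha -> (orlicz_norm P alpha X < u%:E)%E ->
  0 < u /\ ('E_P[fun w => expR ((`|X w| / u) `^ alpha)%R] <= 2%:E)%E.
Proof.
move=> mX al0 /ereal_inf_lt[_ [y [y0 Xy] <-]]; rewrite lte_fin => yu.
have u0 : 0 < u by exact: lt_trans yu.
have mD (c : R) : measurable_fun setT (fun w => expR ((`|X w| / c) `^ alpha)).
  apply/measurable_expR_comp/(measurableT_comp (measurable_powR alpha)).
  by apply: measurable_funM => //; exact: measurable_normr_comp.
split => //; apply: le_trans Xy; apply: ge0_expectation_le => // w.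
rewrite ler_expR; apply: ge0_ler_powR; rewrite ?nnegrE//.
- exact: divr_ge0 (normr_ge0 _) (ltW u0).
- exact: divr_ge0 (normr_ge0 _) (ltW y0).
- by rewrite ler_wpM2l// lef_pV2// ltW.
Qed.

(** Every [u i > orlicz_norm P alpha (X i)] qualifies in the infimum; the
    choice [u i = (N i `^ q + eta) `^ q^-1] makes the loss additive in the
    [q]-th powers. *)
Lemma orlicz_norm_sum_le (I : finType) (X : I -> {RV P >-> R}) (a : I -> R)
    (alpha alpha' q D : R) : 0 <= alpha -> 0 < q -> 0 < D ->
  (forall i, (orlicz_norm P alpha (X i) < +oo)%E) ->
  (forall (A : R) (u : I -> R), 0 < A -> (forall i, 0 < u i) ->
    (forall i, 'E_P[fun w => expR ((`|X i w| / u i) `^ alpha)%R] <= 2%:E)%E ->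
    \sum_i (`|a i| * u i / A) `^ q <= 1 ->
    ('E_P[fun w => expR ((`|(\sum_i a i * X i w)%R| / (D * A)) `^ alpha')%R]
      <= 2%:E)%E) ->
  (orlicz_norm P alpha' (fun w => (\sum_i a i * X i w)%R) <=
    D%:E * (\sum_i (`|a i| `^ q)%:E * orlicz_norm P alpha (X i) `^ q)
      `^ q^-1)%E.
Proof.
move=> al0 q0 D0 Xfin H.
pose N i := fine (orlicz_norm P alpha (X i)).
have NE i : orlicz_norm P alpha (X i) = (N i)%:E.
  by rewrite fineK// ge0_fin_numE// orlicz_norm_ge0.
have N0 i : 0 <= N i by rewrite -lee_fin -NE orlicz_norm_ge0.
pose S := \sum_i `|a i| `^ q * N i `^ q.
have S0 : 0 <= S by apply: sumr_ge0 => i _; rewrite mulr_ge0 ?powR_ge0.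
have -> : (\sum_i (`|a i| `^ q)%:E * orlicz_norm P alpha (X i) `^ q = S%:E)%E.
  by rewrite -sumEFin; apply: eq_bigr => i _; rewrite NE poweR_EFin.
rewrite poweR_EFin -EFinM; apply/lee_addgt0Pr => e e0.
pose A := S `^ q^-1 + e / D.
have eD : 0 < e / D by rewrite divr_gt0.
have A0 : 0 < A by rewrite ltr_wpDl ?powR_ge0.
have -> : ((D * S `^ q^-1)%:E + e%:E)%E = (D * A)%:E.
  by rewrite -EFinD mulrDr; congr (_ + _)%:E; field; rewrite gt_eqF.
have SA : S < A `^ q.
  have -> : S = (S `^ q^-1) `^ q by rewrite -powRrM mulVf ?gt_eqF// powRr1.
  by apply: gt0_ltr_powR; rewrite ?nnegrE ?powR_ge0 ?(ltW A0)// ltrDl.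
pose B := \sum_i `|a i| `^ q.
have B0 : 0 <= B by apply: sumr_ge0 => i _; exact: powR_ge0.
pose eta := (A `^ q - S) / (1 + B).
have eta0 : 0 < eta by rewrite divr_gt0//; lra.
pose u i := (N i `^ q + eta) `^ q^-1.
have uq i : u i `^ q = N i `^ q + eta.
  by rewrite -powRrM mulVf ?gt_eqF// powRr1// addr_ge0 ?powR_ge0// ltW.
have Nu i : N i < u i.
  rewrite ltNge; apply/negP => uN.
  have : u i `^ q <= N i `^ q.
    by apply: ge0_ler_powR; rewrite ?nnegrE ?powR_ge0// ltW.
  by rewrite uq; lra.
have Xu i : 0 < u i /\
    ('E_P[fun w => expR ((`|X i w| / u i) `^ alpha)%R] <= 2%:E)%E.
  by apply: orlicz_norm_lt => //; rewrite NE lte_fin.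
apply: orlicz_norm_le; first exact: mulr_gt0.
apply: (H A u) => // [i|i|]; [exact: (Xu i).1|exact: (Xu i).2|].
have -> : \sum_i (`|a i| * u i / A) `^ q = (S + eta * B) / A `^ q.
  rewrite /S /B mulr_sumr -big_split/= mulr_suml; apply: eq_bigr => i _.
  rewrite !powRM ?mulr_ge0 ?invr_ge0 ?(ltW A0) ?powR_ge0// uq.
  rewrite -powR_inv1 ?(ltW A0)//.
  by rewrite -!powRrM mulN1r powRN; ring.
rewrite ler_pdivrMr ?powR_gt0// mul1r.
have : eta * (1 + B) = A `^ q - S by rewrite /eta divfK// gt_eqF//; lra.
by lra.
Qed.

End OrliczNorm.

Lemma inve_conjugate_fine (R : realType) (alpha : R) (beta : \bar R) :
  1 < alpha -> ((alpha%:E)^-1 + beta^-1 = 1)%E ->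
  alpha^-1 + (fine beta)^-1 = 1.
Proof.
move=> al1; rewrite inver gt_eqF ?(lt_trans ltr01)//.
have : alpha^-1 < 1 by rewrite invf_lt1 ?(lt_trans ltr01).
case: beta => [b||] al //=; last first.
  by rewrite invey adde0 => -[al_eq1]; move: al; rewrite al_eq1 ltxx.
by rewrite inver; case: eqVneq => // _; rewrite -EFinD => -[].
Qed.

Section SecondMomentForm.
Context d (T : measurableType d) (R : realType) (P : probability T R).
Variables (I : finType) (X : I -> {RV P >-> R}) (a : I -> R).

Lemma powR_weights2E (alpha : R) :
  ((\sum_i (`|a i| `^ 2)%:E * orlicz_norm P alpha (X i) `^ 2) `^ 2^-1 =
   (\sum_i (a i ^+ 2)%:E * orlicz_norm P alpha (X i) ^+ 2) `^ 2^-1)%E.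
Proof.
congr (_ `^ _)%E; apply: eq_bigr => i _; congr (_ * _)%E.
  by rewrite -[2]/(2%:R) powR_mulrn// real_normK ?num_real.
have := orlicz_norm_ge0 P alpha (X i); case: orlicz_norm => [r r0||]//.
  by rewrite poweR_EFin -[2]/(2%:R) powR_mulrn.
by move=> _; rewrite poweRyr// expe2.
Qed.

End SecondMomentForm.

(* beta is an extended real, since beta = +oo when alpha = 1. In the case
   2 <= alpha, the only one where beta is used, it is finite, so that
   [fine beta] is its real value. *)
Theorem corollary2 (R : realType) :
  exists C1 C2 : R, 0 < C1 /\ 0 < C2 /\
    forall (d : measure_display) (T : measurableType d) (P : probability T R)
      (alpha : R) (beta : \bar R) (n : nat)
      (X : 'I_n -> {RV P >-> R}) (a : 'I_n -> R),
    1 <= alpha ->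
    ((alpha%:E)^-1 + beta^-1 = 1)%E ->
    mutually_independent X ->
    (forall i, 'E_P[X i] = 0)%E ->
    (forall i, (orlicz_norm P alpha (X i) < +oo)%E) ->
    (2 <= alpha ->
      (orlicz_norm P alpha (fun w => (\sum_(i < n) a i * X i w)%R) <=
        C1%:E *
        (\sum_(i < n)
          (`|a i| `^ fine beta)%:E * orlicz_norm P alpha (X i) `^ fine beta)
        `^ (fine beta)^-1)%E /\
      (orlicz_norm P 2 (fun w => (\sum_(i < n) a i * X i w)%R) <=
        C1%:E *
        (\sum_(i < n) (a i ^+ 2)%:E * orlicz_norm P alpha (X i) ^+ 2)
        `^ 2^-1)%E) /\
    (alpha <= 2 ->
      (orlicz_norm P alpha (fun w => (\sum_(i < n) a i * X i w)%R) <=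
        C2%:E *
        (\sum_(i < n) (a i ^+ 2)%:E * orlicz_norm P alpha (X i) ^+ 2)
        `^ 2^-1)%E).
Proof.
set C := orlicz_const R; have C0 : 0 < C := orlicz_const_gt0 R.
have e1 : 1 + 1 <= expR 1 :> R := expR_ge1Dx 1.
pose E2 : R := 2 * expR 1.
have E21 : 1 <= E2 by rewrite /E2; lra.
have E20 : 0 < E2 by lra.
exists (C * E2), C; split; first exact: mulr_gt0.
split=> // d T P alpha beta n X a al1 ab indep X0 Xfin.
have al0 : 0 <= alpha by lra.
split=> [al2|al2]; last first.
  rewrite -powR_weights2E; apply: orlicz_norm_sum_le => // A u A0 u0 Xu.
  exact: orlicz_sum_subquadratic.
have {}ab := inve_conjugate_fine (lt_le_trans (ltr1n _ 2) al2) ab.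
have be0 : 0 < fine beta.
  have al_gt1 : 1 < alpha by lra.
  by rewrite (conjugate_exponentE al_gt1 ab) divr_gt0//; lra.
split.
  apply: (@le_trans _ _ (C%:E * (\sum_(i < n) (`|a i| `^ fine beta)%:E *
      orlicz_norm P alpha (X i) `^ fine beta) `^ (fine beta)^-1)%E).
    apply: orlicz_norm_sum_le => // A u A0 u0 Xu.
    exact: orlicz_sum_superquadratic.
  by rewrite lee_wpmul2r ?poweR_ge0// lee_fin ler_peMr// ltW.
rewrite -powR_weights2E; apply: orlicz_norm_sum_le => //; first exact: mulr_gt0.
move=> A u A0 u0 Xu sum1.
(* [u' i] qualifies for the [Psi_2] norm: [x `^ 2 <= 1 + x `^ alpha] gives an
   exponential moment at most [E2], and dividing the exponent by [E2] makes it
   at most 2. *)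
pose u' i := E2 * u i.
have Xu' i : ('E_P[fun w => expR ((`|X i w| / u' i) `^ 2)%R] <= 2%:E)%E.
  have mX : measurable_fun setT (fun w => X i w / u i).
    exact: measurable_funM.
  have normE w : `|X i w / u i| = `|X i w| / u i.
    by rewrite normrM [X in _ * X]gtr0_norm ?invr_gt0.
  have XuE : ('E_P[fun w => expR (`|X i w / u i| `^ alpha)%R] <= 2%:E)%E.
    by under eq_fun do rewrite normE.
  have := expectation_expR_powR_le mX (ltr0n _ 2) al2 XuE.
  move=> /(expectation_expR_div (measurable_normr_powR 2 mX) E21).
  apply: le_trans.
  apply: ge0_expectation_le => [||w|w].
  - apply/measurable_expR_comp/(measurableT_comp (measurable_powR 2)).
    apply: measurable_funM => //.
    exact: measurable_normr_comp.
  - apply: measurable_expR_comp; apply: measurable_funM => //.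
    exact: measurable_normr_powR.
  - exact: expR_ge0.
  - have w0 : 0 <= `|X i w| / u i by rewrite -normE.
    rewrite ler_expR normE /u' (_ : _ / (E2 * u i) = E2^-1 * (`|X i w| / u i)).
      rewrite powRM ?invr_ge0 ?(ltW E20)// [leRHS]mulrC.
      rewrite ler_wpM2r ?powR_ge0//; apply: ge1r_powR; last lra.
      by rewrite invr_gt0 E20 invf_le1.
    by field; rewrite !gt_eqF.
have u'0 i : 0 < u' i by exact: mulr_gt0.
rewrite -mulrA; apply: (orlicz_sum_subquadratic indep X0 _ _ _ u'0) => //.
- by lra.
- exact: mulr_gt0.
- apply: le_trans sum1; rewrite le_eqVlt; apply/orP; left; apply/eqP.
  apply: eq_bigr => i _; congr (_ `^ _); rewrite /u'; field.
  by rewrite !gt_eqF.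
Qed.
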